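(* Let $n\ge 5$ be an odd integer. An $a\times b$ rectangle in the square lattice ($a,b\ge 1$ integers) can be signed tiled by $\mathcal{T}_n$ if and only if at least one of $a,b$ is divisible by $n$.
   Context: Work in the square lattice; a cell is a unit square, identified with the integer coordinates $(\alpha,\beta)\in\mathbb{Z}^2$ of its lower left corner. $\mathcal{T}_n=\{T_1,T_2,T_3,T_4\}$ is the set of ribbon $L$-shaped $n$-ominoes, where, as sets of $n$ cells, $T_1=\{(0,j):0\le j\le n-2\}\cup\{(1,0)\}$, $T_2=\{(1,j):0\le j\le n-2\}\cup\{(0,n-2)\}$, $T_3=\{(i,0):0\le i\le n-2\}\cup\{(0,1)\}$, $T_4=\{(i,1):0\le i\le n-2\}\cup\{(n-2,0)\}$. Only translates of the tiles by integer vectors are allowed (no rotations or reflections). A signed tiling of a region $R$ (a set of cells) by $\mathcal{T}_n$ is a finite collection of translates of tiles of $\mathcal{T}_n$ (repetitions allowed), each with a weight $+1$ or $-1$, such that for every cell in $R$ the sum of the weights of the tiles covering it is $1$, and for every cell outside $R$ this sum is $0$. An $a\times b$ rectangle has height $a$ and base $b$ and consists of $ab$ cells. *)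

(* Defs.v *)
From HB Require Import structures.
From mathcomp Require Import all_boot all_order all_algebra.

Set Implicit Arguments.
Unset Strict Implicit.
Unset Printing Implicit Defensive.

Import Order.TTheory GRing.Theory Num.Theory.
Local Open Scope ring_scope.

(* The unit square with lower left corner (alpha, beta); the first coordinate
   is horizontal. *)
Definition cell : Type := (int * int)%type.

Definition region : Type := {pred cell}.

Definition T1 (n : nat) : region :=
  [pred c : cell | ((c.1 == 0) && (0 <= c.2 <= n%:Z - 2)) || (c == (1, 0))].

Definition T2 (n : nat) : region :=
  [pred c : cell |
    ((c.1 == 1) && (0 <= c.2 <= n%:Z - 2)) || (c == (0, n%:Z - 2))].

Definition T3 (n : nat) : region :=
  [pred c : cell | ((c.2 == 0) && (0 <= c.1 <= n%:Z - 2)) || (c == (0, 1))].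

Definition T4 (n : nat) : region :=
  [pred c : cell |
    ((c.2 == 1) && (0 <= c.1 <= n%:Z - 2)) || (c == (n%:Z - 2, 0))].

Inductive tile_name : Type := L1 | L2 | L3 | L4.

Definition tile (n : nat) (t : tile_name) : region :=
  match t with L1 => T1 n | L2 => T2 n | L3 => T3 n | L4 => T4 n end.

Definition translate (v : int * int) (A : region) : region :=
  [pred c : cell | (c.1 - v.1, c.2 - v.2) \in A].

Record signed_tile : Type := SignedTile {
  name : tile_name;
  offset : int * int;
  negative : bool
}.

Definition weight (p : signed_tile) : int := if negative p then -1 else 1.

Definition cells_of (n : nat) (p : signed_tile) : region :=
  translate (offset p) (tile n (name p)).

Definition total_weight (n : nat) (s : seq signed_tile) (c : cell) : int :=
  \sum_(p <- s | c \in cells_of n p) weight p.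

(* A list is used as a finite multiset, so repetitions are allowed. *)
Definition signed_tiling (n : nat) (s : seq signed_tile) (R : region) : Prop :=
  (forall c : cell, c \in R -> total_weight n s c = 1) /\
  (forall c : cell, c \notin R -> total_weight n s c = 0).

Definition signed_tileable (n : nat) (R : region) : Prop :=
  exists s : seq signed_tile, signed_tiling n s R.

(* Height a (vertical), base b (horizontal), lower left cell o. *)
Definition rectangle (o : cell) (a b : nat) : region :=
  [pred c : cell | (o.1 <= c.1 < o.1 + b%:Z) && (o.2 <= c.2 < o.2 + a%:Z)].

(* Main.v *)
(* Encode the cell (i, j) as the monomial x^i y^j. A region can be signed tiled
   iff its polynomial, up to a monomial factor, lies in the ideal generated by
   the four tile polynomials. For odd n this ideal contains x y - 1, and modulo
   x y - 1 every tile becomes, up to a unit, 1 + x + ... + x^(n-1). Hence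
   1 x n and n x 1 bars lie in the ideal; conversely a rectangle in it vanishes
   at (z, z^-1) for z a primitive n-th root of unity, that is
   (z^b - 1) (z^-a - 1) = 0. *)
Require Import Defs.
From mathcomp Require Import all_boot all_order all_algebra all_field.
From mathcomp Require Import zify ring.

Set Implicit Arguments.
Unset Strict Implicit.
Unset Printing Implicit Defensive.

Import Order.TTheory GRing.Theory Num.Theory.
Local Open Scope ring_scope.

(** * Geometric sums and the ideal generated by the tile polynomials *)

Definition geom (A : pzSemiRingType) (x : A) (m : nat) : A := \sum_(i < m) x ^+ i.

Lemma geomS (A : pzSemiRingType) (x : A) m : geom x m.+1 = geom x m + x ^+ m.
Proof. by rewrite /geom big_ord_recr. Qed.

Lemma geomD (A : pzSemiRingType) (x : A) m k :
  geom x (m + k) = geom x m + x ^+ m * geom x k.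
Proof.
rewrite /geom big_split_ord /= mulr_sumr; congr (_ + _).
by apply: eq_bigr => i _; rewrite exprD.
Qed.

(** Pairing consecutive powers gives [y ^+ (2 * i) + y ^+ (2 * i + 1) = (y + 1) * (y ^+ 2) ^+ i].
    This is where the parity of [n] enters. *)
Lemma geom_double (A : comPzRingType) (y : A) k :
  geom y k.*2 = (y + 1) * geom (y ^+ 2) k.
Proof.
elim: k => [|k IHk]; first by rewrite /geom !big_ord0 mulr0.
by rewrite doubleS !geomS IHk -(exprM y 2 k) mul2n (exprS y k.*2); ring.
Qed.

Lemma rmorph_geom (A B : pzSemiRingType) (f : {rmorphism A -> B}) x m :
  f (geom x m) = geom (f x) m.
Proof. by rewrite rmorph_sum; apply: eq_bigr => i _; rewrite rmorphXn. Qed.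

(* Here [n = k.*2.+3] and the hypotheses are the tile polynomials T1, T2, T3,
   T4. Modulo them, [u = x * y - 1] is killed by [x + 1] and
   [y + 1]; since [n] is odd, [y + 1] divides [geom y n.-1], so multiplying
   T1 by [u] shows [u = 0], whence [geom x n = x * T4 - u * geom x n.-1 = 0]. *)
Lemma geom_in_ideal (A : comPzRingType) (I : A -> Prop) (k : nat) (x y : A) :
  (forall p q, I p -> I q -> I (p + q)) -> (forall p q, I q -> I (p * q)) ->
  I (geom y k.*2.+2 + x) -> I (x * geom y k.*2.+2 + y ^+ k.*2.+1) ->
  I (geom x k.*2.+2 + y) -> I (y * geom x k.*2.+2 + x ^+ k.*2.+1) ->
  I (geom x k.*2.+3).
Proof.
move=> ID IM.
set P := geom y _; set Q := geom x k.*2.+2.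
set T1 := P + x; set T2 := _ + y ^+ _; set T3 := Q + y; set T4 := _ + x ^+ _.
move=> I1 I2 I3 I4.
pose u := x * y - 1.
have Py : y ^+ k.*2.+2 - 1 = (y - 1) * P by rewrite subrX1.
have Qx : x ^+ k.*2.+2 - 1 = (x - 1) * Q by rewrite subrX1.
have Iux : I ((x + 1) * u).
  (* In [y * x * T1 - y * T2] the multiples of [P] cancel; adding [(y - 1) * T1] brings in
     [y ^+ k.*2.+2 - 1], whose leading power cancels the one left from [y * T2]. *)
  have -> : (x + 1) * u = (y * x + (y - 1)) * T1 + (- y) * T2.
    have -> : (y * x + (y - 1)) * T1 + (- y) * T2 =
      y * x * x + (y - 1) * x + (y - 1) * P - y * y ^+ k.*2.+1.
      by rewrite /T1 /T2; ring.
    by rewrite -Py -exprS /u; ring.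
  by apply: ID; exact: IM.
have Iuy : I ((y + 1) * u).
  have -> : (y + 1) * u = (x * y + (x - 1)) * T3 + (- x) * T4.
    have -> : (x * y + (x - 1)) * T3 + (- x) * T4 =
      x * y * y + (x - 1) * y + (x - 1) * Q - x * x ^+ k.*2.+1.
      by rewrite /T3 /T4; ring.
    by rewrite -Qx -exprS /u; ring.
  by apply: ID; exact: IM.
have Iu : I u.
  have -> : u = (- u) * T1 + (x + 1) * u + geom (y ^+ 2) k.+1 * ((y + 1) * u).
    by rewrite /T1 /P -doubleS geom_double; ring.
  by apply: (ID _ _ (ID _ _ _ _)) => //; exact: IM.
have -> : geom x k.*2.+3 = x * T4 + (- Q) * u.
  by rewrite geomS -/Q exprS /T4 /u; ring.
by apply: ID; exact: IM.
Qed.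

(** * Polynomials in two variables as integer weights on cells *)

Definition coef2 (p : {poly {poly int}}) (c : cell) : int :=
  match c with (Posz i, Posz j) => p`_i`_j | _ => 0 end.

Lemma coef2D p q c : coef2 (p + q) c = coef2 p c + coef2 q c.
Proof. by case: c => [[i|i] [j|j]] /=; rewrite ?addr0 // !coefD. Qed.

Lemma coef2N p c : coef2 (- p) c = - coef2 p c.
Proof. by case: c => [[i|i] [j|j]] /=; rewrite ?oppr0 // !coefN. Qed.

Lemma coef2_inj p q : coef2 p =1 coef2 q -> p = q.
Proof.
by move=> pq; apply/polyP => i; apply/polyP => j; exact: (pq (Posz i, Posz j)).
Qed.

(** Since [coef2] is 0 off the first quadrant, multiplication by a monomial is a translation at
    every cell, with no side condition on signs. *)
Lemma coef2_XnM p i c : coef2 ('X^i * p) c = coef2 p (c.1 - i%:Z, c.2).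
Proof.
case: c => [[k|k] [j|j]] /=; rewrite ?coefXnM; last 3 first.
- by case: (_ - _).
- by have -> : Negz k - i%:Z = Negz (k + i) by lia.
- by case: (_ - _).
case: ltnP => ki; last by rewrite subzn.
by rewrite coef0; have -> : k%:Z - i%:Z = Negz (i - k).-1 by lia.
Qed.

Lemma coef2_YnM p i c :
  coef2 (('X^i)%:P * p) c = coef2 p (c.1, c.2 - i%:Z).
Proof.
case: c => [[k|k] [j|j]] //=; rewrite ?coefCM ?coefXnM; last first.
  by have -> : Negz j - i%:Z = Negz (j + i) by lia.
case: ltnP => ki; last by rewrite subzn.
by have -> : j%:Z - i%:Z = Negz (i - j).-1 by lia.
Qed.

Notation polyx := ('X : {poly {poly int}}).
Notation polyy := (('X : {poly int})%:P : {poly {poly int}}).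

Definition tile_poly (n : nat) (t : tile_name) : {poly {poly int}} :=
  match t with
  | L1 => geom polyy n.-1 + polyx
  | L2 => polyx * geom polyy n.-1 + polyy ^+ n.-2
  | L3 => geom polyx n.-1 + polyy
  | L4 => polyy * geom polyx n.-1 + polyx ^+ n.-2
  end.

Lemma geom_polyx m : geom polyx m = \poly_(i < m) 1.
Proof. by rewrite poly_def; apply: eq_bigr => i _; rewrite scale1r. Qed.

Lemma geom_polyy m : geom polyy m = (\poly_(i < m) 1)%:P.
Proof.
rewrite -(rmorph_geom polyC) poly_def; congr _%:P.
by apply: eq_bigr => i _; rewrite scale1r.
Qed.

(** The single extra cell of each tile lies off its bar, so all coefficients are 0 or 1. The bound
    on [n] makes the truncated [n.-2] agree with the integer [n%:Z - 2]. *)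
Lemma coef2_tile n t c : (1 < n)%N -> coef2 (tile_poly n t) c = (c \in tile n t)%:R.
Proof.
move=> n1; case: c => i j; case: t => /=; rewrite inE /= ?xpair_eqE.
all: case: i => i; case: j => j //=.
all: rewrite ?geom_polyx ?geom_polyy -?rmorphXn ?(coefD, coefXM, coefC, coefCM, coefX, coef_poly, coefXn).
all: rewrite ?coefMn ?(fun_if (fun p : {poly int} => p`_j)).
all: rewrite ?(fun_if (fun p : {poly int} => p`_j.-1)).
all: rewrite ?(coefMn, coef_poly, coefX, coefXn, coefC, coef0, coef1).
all: try lia.
all: do ?case: ifP; try lia.
Qed.

Lemma coef2_rectangle a b c :
  coef2 (geom polyx b * geom polyy a) c = (c \in rectangle (0, 0) a b)%:R.
Proof.
case: c => i j; rewrite geom_polyx geom_polyy mulrC inE /= !add0r.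
case: i => i; case: j => j //=.
- rewrite !ltz_nat coefCM coef_poly; case: (i < b)%N; rewrite ?mulr0 ?coef0 //.
  by rewrite mulr1 coef_poly; case: (j < a)%N.
- by rewrite andbF.
Qed.

(** * The ideal of polynomials realized by signed tiles *)

Definition shift (v : cell) (p : signed_tile) : signed_tile :=
  SignedTile (name p) ((offset p).1 + v.1, (offset p).2 + v.2) (negative p).

Lemma total_weight_shift n s v c :
  total_weight n (map (shift v) s) c = total_weight n s (c.1 - v.1, c.2 - v.2).
Proof.
rewrite /total_weight big_map; apply: eq_bigl => p.
by rewrite /cells_of /translate !inE /= !opprD !addrA !(addrAC _ (- v.1)) !(addrAC _ (- v.2)).
Qed.

(** Tiles may stick out of the first quadrant, provided that their weights cancel there. *)
Definition realizable (n : nat) (p : {poly {poly int}}) : Prop :=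
  exists s, total_weight n s =1 coef2 p.

Lemma realizable0 n : realizable n 0.
Proof.
by exists [::] => -[[i|i] [j|j]]; rewrite /total_weight big_nil /= ?coef0.
Qed.

Lemma realizableD n p q : realizable n p -> realizable n q -> realizable n (p + q).
Proof.
move=> [s sp] [t tq]; exists (s ++ t) => c.
by rewrite coef2D -sp -tq /total_weight big_cat.
Qed.

Lemma realizableN n p : realizable n p -> realizable n (- p).
Proof.
move=> [s sp]; exists [seq SignedTile (name t) (offset t) (~~ negative t) | t <- s] => c.
rewrite coef2N -sp /total_weight big_map -sumrN; apply: eq_bigr => t _.
by rewrite /weight /=; case: (negative t) => //; rewrite opprK.
Qed.

Lemma realizable_XM n p : realizable n p -> realizable n (polyx * p).
Proof.
move=> [s sp]; exists (map (shift (1, 0)) s) => c.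
by rewrite total_weight_shift sp -['X]expr1 coef2_XnM /= subr0.
Qed.

Lemma realizable_YM n p : realizable n p -> realizable n (polyy * p).
Proof.
move=> [s sp]; exists (map (shift (0, 1)) s) => c.
by rewrite total_weight_shift sp -['X]expr1 coef2_YnM /= subr0.
Qed.

Lemma realizable_intM n (z : int) p : realizable n p -> realizable n (z%:~R * p).
Proof.
have natM k q : realizable n q -> realizable n (k%:R * q).
  move=> Rq; elim: k => [|k IHk]; first by rewrite mul0r; exact: realizable0.
  by rewrite mulrS mulrDl mul1r; exact: realizableD.
case: z => k Rp; first exact: natM.
by rewrite NegzE mulrNz mulNr; apply: realizableN; exact: natM.
Qed.

(** Horner induction on the powers of [x], then on those of [y] in each coefficient, leaves only
    unit shifts and integer multiples. *)
Lemma realizableM n q p : realizable n p -> realizable n (q * p).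
Proof.
move=> Rp; elim/poly_ind: q => [|q c IHq]; first by rewrite mul0r; exact: realizable0.
rewrite mulrDl; apply: realizableD.
  by rewrite -mulrA [q * _]mulrC -mulrA [p * q]mulrC; exact: realizable_XM.
elim/poly_ind: c => [|c z IHc]; first by rewrite mul0r; exact: realizable0.
rewrite rmorphD rmorphM mulrDl; apply: realizableD.
  by rewrite [c%:P * _]mulrC -mulrA; exact: realizable_YM.
by rewrite -[z]intz !rmorph_int; exact: realizable_intM.
Qed.

Lemma realizable_tile n t : (1 < n)%N -> realizable n (tile_poly n t).
Proof.
move=> n1; exists [:: SignedTile t (0, 0) false] => c.
rewrite /total_weight big_cons big_nil /weight /= addr0 coef2_tile //.
by rewrite /cells_of /translate inE /= !subr0 -surjective_pairing; case: (c \in _).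
Qed.

Lemma realizable_geom n m x :
  (3 <= n)%N -> odd n -> (n %| m)%N ->
  x \in [:: polyx; polyy] -> realizable n (geom x m).
Proof.
move=> n3 n_odd /dvdnP[q ->] x_xy.
have Rn : realizable n (geom x n).
  have [k Dn] : exists k, n = k.*2.+3.
    by exists (n - 3)./2; move: (odd_double_half (n - 3)); rewrite oddB // n_odd /=; lia.
  have R t : realizable n (tile_poly k.*2.+3 t).
    by rewrite -Dn; apply: realizable_tile; lia.
  move: x_xy; rewrite !inE; move: (R L1) (R L2) (R L3) (R L4) => {R}.
  rewrite [X in geom _ X]Dn /= => R1 R2 R3 R4 /orP[]/eqP->.
    by apply: (geom_in_ideal (I := realizable n) (y := polyy)) => //; [exact: realizableD | exact: realizableM].
  (* Swapping the variables exchanges T1 with T3 and T2 with T4. *)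
  by apply: (geom_in_ideal (I := realizable n) (y := polyx)) => //; [exact: realizableD | exact: realizableM].
(* A bar of length [q * n] is cut into [q] translated bars of length [n]. *)
elim: q => [|q IHq]; first by rewrite /geom big_ord0; exact: realizable0.
by rewrite mulSn geomD; apply: realizableD => //; exact: realizableM.
Qed.

Lemma realizable_tileable n a b o :
  realizable n (geom polyx b * geom polyy a) -> signed_tileable n (rectangle o a b).
Proof.
move=> [s sP]; exists (map (shift o) s).
have E c : total_weight n (map (shift o) s) c = (c \in rectangle o a b)%:R.
  rewrite total_weight_shift sP coef2_rectangle !inE /= !add0r.
  by rewrite !subr_ge0 !ltrBlDl.
by split=> c; rewrite E; case: (c \in _).
Qed.

(** * Evaluation at a root of unity and its inverse *)

Definition bieval (F : numFieldType) (x y : F) : {rmorphism {poly {poly int}} -> F} :=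
  horner_eval x \o map_poly (horner_eval y \o map_poly (intmul 1)).

Lemma bieval_x (F : numFieldType) (x y : F) : bieval x y polyx = x.
Proof. by rewrite /= map_polyX /horner_eval hornerX. Qed.

Lemma bieval_y (F : numFieldType) (x y : F) : bieval x y polyy = y.
Proof. by rewrite /= map_polyC /horner_eval hornerC /= /horner_eval map_polyX hornerX. Qed.

Lemma geom_root (F : fieldType) (x : F) m : x != 1 -> geom x m = 0 <-> x ^+ m = 1.
Proof.
move=> x1; split=> [g0|xm]; first by apply/eqP; rewrite -subr_eq0 subrX1 [X in _ * X]g0 mulr0.
apply/eqP; have := subrX1 x m; rewrite xm subrr => /esym/eqP.
by rewrite mulf_eq0 subr_eq0 (negbTE x1).
Qed.

(** With [y = x^-1] and [x ^+ n = 1], one has [x = y ^+ n.-1] and [y = x ^+ n.-1]. The extra cell of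
    each tile then supplies the missing last power, so the tile becomes, up to a factor [x] or [y],
    a full geometric sum of length [n], which vanishes. *)
Lemma bieval_tile (F : numFieldType) (x : F) n t :
  (1 < n)%N -> x != 1 -> x ^+ n = 1 -> bieval x x^-1 (tile_poly n t) = 0.
Proof.
case: n => [|[|n]] // _ x1 xn.
have x0 : x != 0 by apply: contra_eq_neq xn => ->; rewrite expr0n eq_sym oner_eq0.
have Gx : geom x n.+2 = 0 by apply/geom_root.
have Gy : geom x^-1 n.+2 = 0.
  by apply/geom_root; rewrite ?invr_eq1 // exprVn xn invr1.
have Ex : x = x^-1 ^+ n.+1.
  by apply: (mulIf (x := x^-1)); rewrite ?invr_eq0 // divff // -exprSr exprVn xn invr1.
have Ey : x^-1 = x ^+ n.+1.
  by apply: (mulIf (x := x)); rewrite // mulVf // -exprSr xn.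
case: t; rewrite [tile_poly _ _]/= !(rmorphD, rmorphM, rmorph_geom, rmorphXn) bieval_x bieval_y.
- by rewrite [X in _ + X]Ex -geomS.
- have -> : x^-1 ^+ n = x * x^-1 ^+ n.+1 by rewrite exprS mulVKf.
  by rewrite -mulrDr -geomS Gy mulr0.
- by rewrite [X in _ + X]Ey -geomS.
- have -> : x ^+ n = x^-1 * x ^+ n.+1 by rewrite exprS mulKf.
  by rewrite -mulrDr -geomS Gx mulr0.
Qed.

(* After a shift into the first quadrant, a signed tiling becomes an identity
   between polynomials. *)
Lemma tileable_bieval (F : numFieldType) (x y : F) n a b o :
  (1 < n)%N -> x != 0 -> y != 0 -> (forall t, bieval x y (tile_poly n t) = 0) ->
  signed_tileable n (rectangle o a b) -> geom x b * geom y a = 0.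
Proof.
move=> n1 x0 y0 tile0 [s [sR sR']].
(* Any [N] that dominates the absolute values of all coordinates of [o] and of the offsets will do;
   the induction adds them up. *)
have [N [oN sN]] : exists N : nat, (0 <= o.1 + N%:Z /\ 0 <= o.2 + N%:Z) /\
    forall v : cell, v \in map offset s -> 0 <= v.1 + N%:Z /\ 0 <= v.2 + N%:Z.
  elim: {sR sR'} s => [|p s [N [oN sN]]].
    by exists (absz o.1 + absz o.2)%N; split=> //; lia.
  exists (N + (absz (offset p).1 + absz (offset p).2))%N; split; first lia.
  move=> [v1 v2]; rewrite inE => /predU1P[<-|/sN] /=; lia.
pose mon (v : cell) : {poly {poly int}} :=
  'X^(absz (v.1 + N%:Z)) * ('X^(absz (v.2 + N%:Z)))%:P.
have coef_mon v p c : 0 <= v.1 + N%:Z /\ 0 <= v.2 + N%:Z ->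
    coef2 (mon v * p) c = coef2 p (c.1 - (v.1 + N%:Z), c.2 - (v.2 + N%:Z)).
  by case=> v1 v2; rewrite -mulrA coef2_XnM coef2_YnM !gez0_abs.
(* The monomial introduced by the shift can thus be cancelled after evaluation. *)
have mon_neq0 v : bieval x y (mon v) != 0.
  rewrite rmorphM polyC_exp !rmorphXn.
  by rewrite [X in X ^+ _ * _]bieval_x [X in _ * X ^+ _]bieval_y mulf_neq0 // expf_neq0.
pose q := \sum_(p <- s) (weight p)%:~R * (mon (offset p) * tile_poly n (name p)).
(* At each cell [c], both sides have as coefficient the total weight of [s] at [c] moved back by
   [(N, N)]. *)
have q_eq : q = mon o * (geom polyx b * geom polyy a).
  apply: coef2_inj => c; rewrite coef_mon // coef2_rectangle.
  have -> : ((c.1 - (o.1 + N%:Z), c.2 - (o.2 + N%:Z)) \in rectangle (0, 0) a b) =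
      ((c.1 - N%:Z, c.2 - N%:Z) \in rectangle o a b).
    by rewrite !inE /=; lia.
  transitivity (total_weight n s (c.1 - N%:Z, c.2 - N%:Z)); last first.
    by case: (boolP (_ \in rectangle _ _ _)) => [/sR|/sR'].
  rewrite /total_weight {}/q {sR sR'}; elim: s sN => [|p s IHs] sN.
    by rewrite !big_nil; case: c => -[i|i] [j|j]; rewrite //= !coef0.
  rewrite !big_cons coef2D IHs; last by move=> v vs; apply: sN; rewrite inE vs orbT.
  have Ep : coef2 (mon (offset p) * tile_poly n (name p)) c =
      ((c.1 - N%:Z, c.2 - N%:Z) \in cells_of n p)%:R.
    rewrite coef_mon; last by apply: sN; rewrite inE eqxx.
    rewrite coef2_tile // /cells_of /translate inE /=.
    by rewrite !opprD !addrA !(addrAC _ (- N%:Z)).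
  rewrite /weight; case: (negative p); rewrite ?mulN1r ?mul1r ?coef2N Ep.
    by case: ifP => _; rewrite ?oppr0 ?add0r.
  by case: ifP => _; rewrite ?add0r.
have : bieval x y q = 0.
  by rewrite rmorph_sum big1 // => p _; rewrite !rmorphM /= [X in _ * (_ * X)]tile0 !mulr0.
rewrite q_eq rmorphM => /eqP; rewrite mulf_eq0 (negbTE (mon_neq0 o)) => /eqP.
by rewrite rmorphM !rmorph_geom bieval_x bieval_y.
Qed.

Theorem theorem1 (n a b : nat) (o : cell) :
  (5 <= n)%N -> odd n -> (1 <= a)%N -> (1 <= b)%N ->
  signed_tileable n (rectangle o a b) <-> (n %| a)%N \/ (n %| b)%N.
Proof.
move=> n5 n_odd _ _; split=> [tiled|]; last first.
  have n3 : (3 <= n)%N by apply: leq_trans n5.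
  (* The rectangle is a product of two bars, and the one whose length is a multiple of [n] is
     already in the ideal. *)
  case=> [na|nb]; apply: realizable_tileable.
    by apply: realizableM; apply: realizable_geom; rewrite ?inE ?eqxx ?orbT.
  by rewrite mulrC; apply: realizableM; apply: realizable_geom; rewrite ?inE ?eqxx.
have n0 : (0 < n)%N by apply: leq_trans n5.
have n1 : (1 < n)%N by apply: leq_trans n5.
have [z zP] := C_prim_root_exists n0.
have zn1 : z != 1.
  by apply: contraTneq n1 => z1; rewrite -leqNgt dvdn_leq // (prim_order_dvd zP) z1 expr1.
have z0 : z != 0 by rewrite (prim_root_eq0 zP) -lt0n.
have := tileable_bieval n1 z0 _ _ tiled => /(_ z^-1).
rewrite invr_eq0 => /(_ z0 (fun t => bieval_tile t n1 zn1 (prim_expr_order zP)))/eqP.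
(* Either [z ^+ b = 1] or [z^-1 ^+ a = 1]; as [z] has order exactly [n], these give [n %| b] and
   [n %| a]. *)
rewrite mulf_eq0 => /orP[]/eqP/geom_root; rewrite ?invr_eq1 => /(_ zn1).
  by move/eqP; rewrite -(prim_order_dvd zP); right.
by move/eqP; rewrite exprVn invr_eq1 -(prim_order_dvd zP); left.
Qed.
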